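(* For a meet-semilattice $\mathcal M$, let $B(\mathcal M)$ be the ordered topological space whose underlying set is the set $X_{\mathcal M}$ of all filters on $\mathcal M$, endowed with the topology generated by the sets $\{F\in X_{\mathcal M} : m\in F\}$ ($m\in\mathcal M$) and their complements in $X_{\mathcal M}$, and with the order $F\le_{\mathcal M}F'$ iff $F\subseteq F'$. For a meet-semilattice homomorphism $f:\mathcal M\to\mathcal N$ let $B(f):X_{\mathcal N}\to X_{\mathcal M}$ be $F\mapsto f^{-1}(F)$. Then $B$ is a functor $\mathbf{MsLat}^{\mathrm{op}}\to\mathbf{PTop}$ which yields a duality between $\mathbf{MsLat}$ and a category of Priestley spaces, namely the extended image of $B$ (that is, an equivalence between $\mathbf{MsLat}^{\mathrm{op}}$ and this extended image), and the extended image of $B$ is the category whose objects are the Priestley spaces $(X,\tau,\le)$ such that (i) for any $x,y\in X$ with $x\nleq y$ there is a weakly indecomposable clopen $\le$-upper set $U$ of $\tau$ with $x\in U$ and $y\notin U$, and (ii) the intersection of any two weakly indecomposable clopen $\le$-upper sets is weakly indecomposable, and whose arrows are the continuous order-preserving maps between such spaces such that the inverse image of any weakly indecomposable upper clopen set is weakly indecomposable.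
   Context: Meet-semilattices have a top element, and meet-semilattice homomorphisms preserve binary meets and the top element; $\mathbf{MsLat}$ is the resulting category. A filter on $\mathcal M$ is an upward closed subset containing the top element and closed under binary meets. $\mathbf{PTop}$: objects are triples $(X,\tau,\le)$ with $\tau$ a topology and $\le$ a preorder on $X$; arrows are continuous order-preserving maps. A Priestley space is a compact partially ordered topological space such that whenever $x\nleq y$ there is a clopen upper set containing $x$ and not $y$. A clopen upper set of a Priestley space is weakly indecomposable if it cannot be decomposed as a proper union of clopen upper sets; these are precisely the upper open sets $U$ that are supercompact among the upper open sets (every covering of $U$ by upper open subsets of $U$ has $U$ itself as a member). The extended image of a functor $F:\mathcal U\to\mathcal V$ is the smallest subcategory of $\mathcal V$ closed under isomorphisms in $\mathcal V$ through which $F$ factors.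
   Formalization: Condition (ii) also requires the whole space X to be weakly indecomposable; without this the statement fails: the discrete poset {a,b,t} with a<t, b<t satisfies (i) and (ii) but has no least element, unlike every B(M). *)

(* Defs.v *)
From HB Require Import structures.
From mathcomp Require Import all_boot all_order.
From mathcomp Require Import boolp classical_sets topology.

Set Implicit Arguments.
Unset Strict Implicit.
Unset Printing Implicit Defensive.

Import Order.TTheory.
Local Open Scope classical_set_scope.

Record category := Category {
  obj :> Type;
  hom : obj -> obj -> Type;
  idm : forall A, hom A A;
  comp : forall A B C, hom B C -> hom A B -> hom A C;
  compmA : forall A B C D (h : hom C D) (g : hom B C) (f : hom A B),
    comp h (comp g f) = comp (comp h g) f;
  comp1m : forall A B (f : hom A B), comp (idm B) f = f;
  compm1 : forall A B (f : hom A B), comp f (idm A) = f }.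

Arguments hom {c} A B.
Arguments idm {c} A.
Arguments comp {c A B C} g f : rename.

Program Definition op (C : category) : category :=
  @Category C (fun A B => @hom C B A) (fun A => idm A)
    (fun _ _ _ g f => comp f g) _ _ _.
Next Obligation. by move=> *; symmetry; exact: compmA. Qed.
Next Obligation. by move=> *; exact: compm1. Qed.
Next Obligation. by move=> *; exact: comp1m. Qed.

Definition is_iso (C : category) (A B : C) (f : hom A B) : Prop :=
  exists g : hom B A, comp g f = idm A /\ comp f g = idm B.

Definition is_functor (C D : category) (Fo : C -> D)
    (Fm : forall A B : C, hom A B -> hom (Fo A) (Fo B)) : Prop :=
  (forall A : C, Fm A A (idm A) = idm (Fo A)) /\
  (forall (A B E : C) (g : hom B E) (f : hom A B),
     Fm A E (comp g f) = comp (Fm B E g) (Fm A B f)).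

Record functor (C D : category) := Functor {
  fobj :> C -> D;
  fmap : forall A B : C, hom A B -> hom (fobj A) (fobj B);
  functorP : is_functor fmap }.

Arguments fmap {C D} F {A B} f : rename.

Program Definition id_functor (C : category) : functor C C :=
  @Functor C C id (fun _ _ f => f) _.
Next Obligation. by []. Qed.

Program Definition comp_functor (C D E : category)
    (G : functor D E) (F : functor C D) : functor C E :=
  @Functor C E (fun A => G (F A)) (fun _ _ f => fmap G (fmap F f)) _.
Next Obligation.
move=> C D E G F; split=> [A|A B E' g f].
  by rewrite (functorP F).1 (functorP G).1.
by rewrite (functorP F).2 (functorP G).2.
Qed.

Definition nat_iso (C D : category) (F G : functor C D) : Prop :=
  exists t : forall A : C, hom (F A) (G A),
    (forall (A B : C) (f : hom A B),
       comp (t B) (fmap F f) = comp (fmap G f) (t A)) /\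
    (forall A : C, is_iso (t A)).

Definition is_equivalence (C D : category) (F : functor C D) : Prop :=
  exists G : functor D C,
    nat_iso (comp_functor G F) (id_functor C) /\
    nat_iso (comp_functor F G) (id_functor D).

Record subcategory (C : category) := Subcategory {
  sobj : C -> Prop;
  shom : forall A B : C, hom A B -> Prop;
  shom_dom : forall (A B : C) (f : hom A B), shom f -> sobj A;
  shom_cod : forall (A B : C) (f : hom A B), shom f -> sobj B;
  shom_id : forall A : C, sobj A -> shom (idm A);
  shom_comp : forall (A B E : C) (g : hom B E) (f : hom A B),
    shom g -> shom f -> shom (comp g f) }.

Arguments shom {C} S {A B} f : rename.

Lemma sval_eq (T : Type) (P : T -> Prop) (s t : {x : T | P x}) :
  sval s = sval t -> s = t.
Proof. by case: s t => s Ps [t Pt] /= st; exact: eq_exist. Qed.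

Program Definition subcat (C : category) (S : subcategory C) : category :=
  @Category {A : C | sobj S A}
    (fun A B => {f : hom (sval A) (sval B) | shom S f})
    (fun A => exist _ (idm (sval A)) (shom_id (svalP A)))
    (fun A B E g f =>
       exist _ (comp (sval g) (sval f)) (shom_comp (svalP g) (svalP f)))
    _ _ _.
Next Obligation. by move=> *; apply: sval_eq; rewrite /= compmA. Qed.
Next Obligation. by move=> *; apply: sval_eq; rewrite /= comp1m. Qed.
Next Obligation. by move=> *; apply: sval_eq; rewrite /= compm1. Qed.

(* By [shom_cod], a replete subcategory contains, with an object [A], every
   object isomorphic to [A] as well. *)
Definition replete (C : category) (S : subcategory C) : Prop :=
  forall (A B : C) (f : hom A B), sobj S A -> is_iso f -> shom S f.

Definition factors_through (C D : category) (F : functor C D)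
    (S : subcategory D) : Prop :=
  (forall A : C, sobj S (F A)) /\
  (forall (A B : C) (f : hom A B), shom S (fmap F f)).

(* The smallest subcategory closed under isomorphisms through which [F]
   factors, as the intersection of all of them. *)
Program Definition extended_image (C D : category) (F : functor C D) :
    subcategory D :=
  @Subcategory D
    (fun X => forall S, replete S -> factors_through F S -> sobj S X)
    (fun X Y f => forall S, replete S -> factors_through F S -> shom S f)
    _ _ _ _.
Next Obligation. by move=> C D F A B f H S rS FS; exact: shom_dom (H S rS FS). Qed.
Next Obligation. by move=> C D F A B f H S rS FS; exact: shom_cod (H S rS FS). Qed.
Next Obligation. by move=> C D F A H S rS FS; apply: shom_id; exact: H. Qed.
Next Obligation. by move=> C D F A B E g f Hg Hf S rS FS; apply: shom_comp; [exact: Hg|exact: Hf]. Qed.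

Lemma extended_image_replete (C D : category) (F : functor C D) :
  replete (extended_image F).
Proof. by move=> A B f HA fiso S rS FS; apply: (rS) => //; exact: HA. Qed.

Lemma extended_image_factors (C D : category) (F : functor C D) :
  factors_through F (extended_image F).
Proof. by split=> [A S _ FS|A B f S _ FS]; [exact: FS.1|exact: FS.2]. Qed.

Program Definition corestriction (C D : category) (F : functor C D) :
    functor C (subcat (extended_image F)) :=
  @Functor C (subcat (extended_image F))
    (fun A => exist _ (F A) ((extended_image_factors F).1 A))
    (fun A B f => exist _ (fmap F f) ((extended_image_factors F).2 A B f)) _.
Next Obligation.
move=> C D F; split=> [A|A B E g f]; apply: sval_eq => /=.
  exact: (functorP F).1.
exact: (functorP F).2.
Qed.

(* The display of an order structure only drives printing, hence it is fixed
   once and for all. *)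
Definition mslat := tMeetSemilatticeType (Order.Disp tt tt).

Record mslat_hom (M N : mslat) := MslatHom {
  mslat_fun :> M -> N;
  mslat_funI : forall x y : M,
    mslat_fun (x `&` y)%O = (mslat_fun x `&` mslat_fun y)%O;
  mslat_fun1 : mslat_fun \top%O = \top%O }.

Lemma mslat_hom_eq (M N : mslat) (f g : mslat_hom M N) :
  mslat_fun f = mslat_fun g -> f = g.
Proof.
case: f g => f fI f1 [g gI g1] /= fg; rewrite -fg in gI g1 *.
by congr MslatHom; exact: Prop_irrelevance.
Qed.

Program Definition MsLat : category :=
  @Category mslat mslat_hom (fun M => @MslatHom M M id _ _)
    (fun _ _ _ g f => @MslatHom _ _ (g \o f) _ _) _ _ _.
Next Obligation. by []. Qed.
Next Obligation. by []. Qed.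
Next Obligation. by move=> M N P g f x y /=; rewrite !mslat_funI. Qed.
Next Obligation. by move=> M N P g f /=; rewrite !mslat_fun1. Qed.
Next Obligation. by move=> *; exact: mslat_hom_eq. Qed.
Next Obligation. by move=> *; exact: mslat_hom_eq. Qed.
Next Obligation. by move=> *; exact: mslat_hom_eq. Qed.

Record ptop := PTopObj {
  ptop_space :> topologicalType;
  ple : ptop_space -> ptop_space -> Prop;
  ple_refl : forall x, ple x x;
  ple_trans : forall x y z, ple x y -> ple y z -> ple x z }.

Arguments ple {X} x y : rename.

Record ptop_hom (X Y : ptop) := PTopHom {
  ptop_fun :> X -> Y;
  ptop_fun_cts : continuous ptop_fun;
  ptop_fun_le : forall x y : X, ple x y -> ple (ptop_fun x) (ptop_fun y) }.

Lemma ptop_hom_eq (X Y : ptop) (f g : ptop_hom X Y) :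
  ptop_fun f = ptop_fun g -> f = g.
Proof.
case: f g => f fc fl [g gc gl] /= fg; rewrite -fg in gc gl *.
by congr PTopHom; exact: Prop_irrelevance.
Qed.

Program Definition PTop : category :=
  @Category ptop ptop_hom (fun X => @PTopHom X X id _ _)
    (fun _ _ _ g f => @PTopHom _ _ (g \o f) _ _) _ _ _.
Next Obligation. by move=> X x; exact: cvg_id. Qed.
Next Obligation. by []. Qed.
Next Obligation.
by move=> X Y Z g f x; apply: continuous_comp; exact: ptop_fun_cts.
Qed.
Next Obligation. by move=> X Y Z g f x y xy; do 2 apply: ptop_fun_le. Qed.
Next Obligation. by move=> *; exact: ptop_hom_eq. Qed.
Next Obligation. by move=> *; exact: ptop_hom_eq. Qed.
Next Obligation. by move=> *; exact: ptop_hom_eq. Qed.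

Record mfilter (M : mslat) := MFilter {
  mfilter_set : set M;
  mfilter_up : forall x y : M, (x <= y)%O -> mfilter_set x -> mfilter_set y;
  mfilter1 : mfilter_set \top%O;
  mfilterI : forall x y : M,
    mfilter_set x -> mfilter_set y -> mfilter_set (x `&` y)%O }.

HB.instance Definition _ (M : mslat) := gen_eqMixin (mfilter M).
HB.instance Definition _ (M : mslat) := gen_choiceMixin (mfilter M).

Definition mfilter_subbase (M : mslat) : set (set (mfilter M)) :=
  [set A | exists m : M, A = [set F : mfilter M | mfilter_set F m] \/
                         A = ~` [set F : mfilter M | mfilter_set F m]].

HB.instance Definition _ (M : mslat) :=
  isSubBaseTopological.Build (mfilter M) (@mfilter_subbase M) id.

Program Definition filter_space (M : mslat) : ptop :=
  @PTopObj (mfilter M) (fun F G => mfilter_set F `<=` mfilter_set G) _ _.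
Next Obligation. by move=> M F; exact: subset_refl. Qed.
Next Obligation. by move=> M F G H FG GH; exact: subset_trans GH. Qed.

Definition upper_set (X : ptop) (U : set X) : Prop :=
  forall x y : X, ple x y -> U x -> U y.

Definition clopen_upper (X : ptop) (U : set X) : Prop :=
  clopen U /\ upper_set U.

Definition priestley (X : ptop) : Prop :=
  [/\ compact [set: X],
      forall x y : X, ple x y -> ple y x -> x = y &
      forall x y : X, ~ ple x y -> exists U : set X,
        [/\ clopen_upper U, U x & ~ U y] ].

(* A union is proper when the set is not one of its members. The family [C]
   may be empty, hence the empty set is not weakly indecomposable; this is the
   convention under which weakly indecomposable means supercompact. *)
Definition weakly_indecomposable (X : ptop) (U : set X) : Prop :=
  clopen_upper U /\
  forall C : set (set X), (forall V, C V -> clopen_upper V) ->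
    U = \bigcup_(V in C) V -> C U.

Definition wi_separated (X : ptop) : Prop :=
  forall x y : X, ~ ple x y -> exists U : set X,
    [/\ weakly_indecomposable U, U x & ~ U y].

(* Closure under finite intersections. The empty intersection [setT] cannot be
   omitted: the discrete space on {a, b, t} with a < t and b < t is separated
   by its weakly indecomposable sets {t}, {a, t}, {b, t}, which are closed under
   binary intersection, but has no least element, whereas the least filter
   {\top} is a least element of every [filter_space M]. *)
Definition wi_meet_closed (X : ptop) : Prop :=
  weakly_indecomposable [set: X] /\
  forall U V : set X, weakly_indecomposable U -> weakly_indecomposable V ->
    weakly_indecomposable (U `&` V).

Definition wi_preserving (X Y : ptop) (f : X -> Y) : Prop :=
  forall U : set Y, weakly_indecomposable U ->
    weakly_indecomposable (f @^-1` U).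

(* Main.v *)
Require Import Defs.
From mathcomp Require Import all_boot all_order.
From mathcomp Require Import boolp classical_sets topology.
From HB Require Import structures.
Local Open Scope classical_set_scope.

Set Implicit Arguments.
Unset Strict Implicit.
Unset Printing Implicit Defensive.
Import Order.TTheory.

(** A meet-semilattice [M] is recovered from its filter space because the
    weakly indecomposable clopen upper sets of that space are exactly the sets
    [containing m] of all filters through [m].  Each of these has a least
    element, the principal filter of [m], so in a cover of it by upper sets the
    member covering the least element is already everything
    ([containing_wi]); conversely every filter is the limit of the principal
    filters of its elements ([principal_cvg]), so an open upper set is a union
    of such sets and, when weakly indecomposable, equals one of them
    ([wi_containing]).  Hence [m |-> containing m] is an isomorphism from [M]
    onto the semilattice of weakly indecomposable sets ([containing_iso]).

    In the other direction, a point [x] of a space [X] satisfying the three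
    conditions of the theorem gives the filter of the weakly indecomposable
    sets through [x].  This map is injective and reflects the order by
    separation.  It is onto by compactness: in a Priestley space a weakly
    indecomposable set is the set of points above some point
    ([priestley_wi_principal]), and given a filter of such sets, any cluster
    point of the net of their least points induces that filter ([unit_surj]).
    A continuous bijection from a compact space to a Hausdorff space being a
    homeomorphism, [X] is isomorphic to a filter space ([unit_iso]).

    For the extended image, the spaces satisfying the conditions and the maps
    preserving weakly indecomposable sets form a replete subcategory through
    which the filter functor factors, which bounds the extended image from
    above.  It is also bounded from below, because naturality of the unit
    writes every such map [f] as the inverse of a unit, after the image of
    [U |-> f @^-1` U] under the filter functor, after a unit
    ([wi_preserving_shom]).  The two natural isomorphisms above give the
    equivalence. *)

(** * Isomorphisms in categories *)

Lemma is_iso_op (C : category) (A B : C) (f : @hom C A B) :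
  is_iso f -> @is_iso (op C) B A f.
Proof. by case=> g [gf fg]; exists g. Qed.

Lemma is_iso_subcat (C : category) (S : subcategory C)
    (A B : subcat S) (f : hom A B) :
  replete S -> is_iso (sval f) -> is_iso f.
Proof.
move=> rS [g [gf fg]].
have Sg : shom S g by apply: rS; [exact: svalP|exists (sval f)].
by exists (exist _ g Sg); split; exact: sval_eq.
Qed.

Lemma nat_iso_sym (C D : category) (F G : functor C D) :
  nat_iso F G -> nat_iso G F.
Proof.
case=> t [t_nat t_iso].
pose s A := projT1 (cid (t_iso A)).
have st A : Defs.comp (s A) (t A) = idm (F A) by case: (projT2 (cid (t_iso A))).
have ts A : Defs.comp (t A) (s A) = idm (G A) by case: (projT2 (cid (t_iso A))).
exists s; split=> [A B f|A]; last by exists (t A).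
rewrite -[Defs.fmap G f]compm1 -(ts A).
rewrite [Defs.comp (Defs.fmap G f) _]compmA -t_nat.
by rewrite !compmA st comp1m.
Qed.

(** * The space of filters *)

Definition containing (M : mslat) (m : M) : set (filter_space M) :=
  [set F : mfilter M | mfilter_set F m].

Lemma mfilter_eq (M : mslat) (F G : filter_space M) :
  mfilter_set F = mfilter_set G -> F = G.
Proof.
case: F G => F Fu F1 FI [G Gu G1 GI] /= FG; rewrite -FG in Gu G1 GI *.
by congr MFilter; exact: Prop_irrelevance.
Qed.

Program Definition principal (M : mslat) (m : M) : filter_space M :=
  @MFilter M [set n | (m <= n)%O] _ _ _.
Next Obligation. by move=> M m x y xy mx; exact: le_trans mx xy. Qed.
Next Obligation. by move=> M m; exact: lex1. Qed.
Next Obligation. by move=> M m x y mx my; rewrite /= lexI mx my. Qed.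

Lemma open_containing (M : mslat) (m : M) : open (containing m).
Proof.
exists [set containing m]; last by rewrite bigcup_set1.
by move=> _ ->; apply: finI_from1; exists m; left.
Qed.

Lemma open_containingC (M : mslat) (m : M) : open (~` containing m).
Proof.
exists [set ~` containing m]; last by rewrite bigcup_set1.
by move=> _ ->; apply: (@finI_from1 _ _ _ id); exists m; right.
Qed.

Lemma clopen_containing (M : mslat) (m : M) : clopen (containing m).
Proof.
by split; [exact: open_containing|rewrite -openC; exact: open_containingC].
Qed.

(** The neighbourhoods of [p] are generated under finite intersections by the
    subbasic sets through [p].  Compactness, continuity of maps into a filter
    space and density of principal filters all reduce to this test. *)
Lemma filter_space_cvg (M : mslat) (FF : set_system (filter_space M))
    (p : filter_space M) : Filter FF ->
  (forall m, mfilter_set p m -> FF (containing m)) ->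
  (forall m, ~ mfilter_set p m -> FF (~` containing m)) ->
  FF --> p.
Proof.
move=> FFF Fin Fout A; rewrite /= nbhsE => -[V [[D DV <-] [W DW Wp]] VA].
apply: filterS (VA) _; apply: (@filterS _ _ _ W) => [q Wq|]; first by exists W.
have [E ED WE] := DV _ DW; rewrite -WE.
apply: filter_bigI => B BE; have Bp : B p by move: Wp; rewrite -WE; apply.
have [m [Bm|Bm]] := set_mem (ED _ BE); rewrite Bm in Bp *.
  exact: Fin.
exact: Fout.
Qed.

(** An ultrafilter of filters converges to the filter of those elements that
    belong to almost all of them; the complementary subbasic sets are handled
    by the ultrafilter dichotomy. *)
Lemma filter_space_compact (M : mslat) : compact [set: filter_space M].
Proof.
rewrite compact_ultra => G GU _.
have GF : Filter G by exact: ultra_proper.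
have Gup (x y : M) : (x <= y)%O -> G (containing x) -> G (containing y).
  by move=> xy; apply: filterS => F; exact: mfilter_up.
have G1 : G (containing \top%O) by apply: filterE => F; exact: mfilter1.
have GI (x y : M) : G (containing x) -> G (containing y) ->
    G (containing (x `&` y)%O).
  by apply: filterS2 => F; exact: mfilterI.
exists (@MFilter M [set m | G (containing m)] Gup G1 GI); split=> //.
apply: filter_space_cvg => // m /= Gm.
by have [] := in_ultra_setVsetC (containing m) GU.
Qed.

Lemma continuous_to_filter_space (X : topologicalType) (M : mslat)
    (f : X -> filter_space M) :
  (forall m, clopen (f @^-1` containing m)) -> continuous f.
Proof.
move=> fm x; apply: filter_space_cvg => m fxm.
  exact: open_nbhs_nbhs (conj (fm m).1 fxm).
have [_] := fm m; rewrite -openC => om.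
exact: open_nbhs_nbhs (conj om fxm).
Qed.

Lemma filter_space_hausdorff (M : mslat) : hausdorff_space (filter_space M).
Proof.
move=> F G FG; apply: mfilter_eq; apply/seteqP; split=> m mF.
  apply: contrapT => mG.
  by have [H []] := FG _ _ (open_nbhs_nbhs (conj (open_containing m) mF))
                           (open_nbhs_nbhs (conj (open_containingC m) mG)).
apply: contrapT => mG.
by have [H []] := FG _ _ (open_nbhs_nbhs (conj (open_containingC m) mG))
                         (open_nbhs_nbhs (conj (open_containing m) mF)).
Qed.

Lemma upper_containing (M : mslat) (m : M) : upper_set (containing m).
Proof. by move=> F G; apply. Qed.

(** Only the upper sets in a cover matter: the member that contains the
    principal filter of [m] contains everything above it. *)
Lemma containing_wi (M : mslat) (m : M) : weakly_indecomposable (containing m).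
Proof.
split; first by split; [exact: clopen_containing|exact: upper_containing].
move=> C CU mC; have : containing m (principal m) by exact: lexx.
rewrite {1}mC => -[V CV Vm]; suff -> : containing m = V by [].
apply/seteqP; split=> [F Fm|F VF]; last by rewrite mC; exists V.
by apply: (CU _ CV).2 Vm => n mn; exact: mfilter_up mn Fm.
Qed.

(** The eventuality filter of the net [s] indexed by the elements of [F], a set
    directed by the reverse order because [F] is closed under meets. *)
Definition tails (M : mslat) (F : filter_space M) (T : Type) (s : M -> T) :
    set_system T :=
  filter_from (mfilter_set F)
    (fun m => [set s n | n in [set n | mfilter_set F n /\ (n <= m)%O]]).

Lemma tails_proper (M : mslat) (F : filter_space M) (T : Type) (s : M -> T) :
  ProperFilter (tails F s).
Proof.
apply: filter_from_proper => [|m Fm]; last by exists (s m), m.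
apply: filter_from_filter; first by exists \top%O; exact: mfilter1.
move=> m n Fm Fn; exists (m `&` n)%O; first exact: mfilterI.
by move=> _ [k [Fk /= +] <-]; rewrite lexI => /andP[km kn]; split; exists k.
Qed.

(** An element [m] of [F] lies in the principal filter of every [n <= m], while
    an element outside [F] lies in the principal filter of no [n] in [F]. *)
Lemma principal_cvg (M : mslat) (F : filter_space M) :
  tails F (@principal M) --> F.
Proof.
apply: filter_space_cvg => [|m Fm|m Fm].
- exact: (@filter_filter _ _ (tails_proper F _)).
- by exists m => // _ [n [_ nm] <-].
- exists \top%O => [|_ [n [Fn _] <-] nm]; first exact: mfilter1.
  exact/Fm/(mfilter_up nm).
Qed.

(** By density of principal filters, [U] is the union of the sets
    [containing m] that are included in it, so indecomposability picks one. *)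
Lemma wi_containing (M : mslat) (U : set (filter_space M)) :
  weakly_indecomposable U -> exists m, U = containing m.
Proof.
case=> -[[oU _] upU] UC.
pose C := [set V | exists2 m, U (principal m) & V = containing m].
have [||m _ ->] := UC C; last by exists m.
- by move=> _ [m _ ->]; exact: (containing_wi m).1.
apply/seteqP; split=> [F UF|F [_ [m Um ->] Fm]]; last first.
  by apply: upU Um => n mn; exact: mfilter_up mn Fm.
have [m Fm mU] := principal_cvg (open_nbhs_nbhs (conj oU UF)).
exists (containing m) => //; exists m => //.
by apply: mU; exists m => /=.
Qed.

Lemma containing_sub_le (M : mslat) (m n : M) :
  containing m `<=` containing n -> (m <= n)%O.
Proof. by move=> /(_ (principal m)); apply; exact: lexx. Qed.

Lemma containingI (M : mslat) (m n : M) :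
  containing (m `&` n)%O = containing m `&` containing n.
Proof.
apply/seteqP; split=> [F Fmn|F [Fm Fn]]; last exact: mfilterI.
by split; apply: mfilter_up Fmn; [exact: leIl|exact: leIr].
Qed.

Lemma containing1 (M : mslat) : containing (\top%O : M) = setT.
Proof. by apply/seteqP; split=> // F _; exact: mfilter1. Qed.

Lemma filter_space_wi_separated (M : mslat) : wi_separated (filter_space M).
Proof.
move=> F G FG; have [m [Fm Gm]] :
    exists m, mfilter_set F m /\ ~ mfilter_set G m.
  apply: contrapT => FG'; apply: FG => m Fm; apply: contrapT => Gm.
  by apply: FG'; exists m.
by exists (containing m); split=> //; exact: containing_wi.
Qed.

Lemma filter_space_priestley (M : mslat) : priestley (filter_space M).
Proof.
split=> [|F G FG GF|F G /filter_space_wi_separated[U [[Uc _] UF UG]]].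
- exact: filter_space_compact.
- by apply: mfilter_eq; apply/seteqP.
- by exists U.
Qed.

Lemma filter_space_wi_meet_closed (M : mslat) : wi_meet_closed (filter_space M).
Proof.
split=> [|U V /wi_containing[m ->] /wi_containing[n ->]].
  by rewrite -containing1; exact: containing_wi.
by rewrite -containingI; exact: containing_wi.
Qed.

(** * The filter functor *)

Program Definition filter_preimage (M N : mslat) (f : mslat_hom M N) :
    ptop_hom (filter_space N) (filter_space M) :=
  @PTopHom (filter_space N) (filter_space M)
    (fun F => @MFilter M (f @^-1` (mfilter_set F)) _ _ _) _ _.
Next Obligation.
move=> M N f F x y xy; rewrite /preimage /=; apply: mfilter_up.
rewrite leEmeet -mslat_funI; apply/eqP; congr (f _); apply/eqP.
by rewrite -leEmeet.
Qed.
Next Obligation.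
by move=> M N f F; rewrite /preimage /= mslat_fun1; exact: mfilter1.
Qed.
Next Obligation.
by move=> M N f F x y; rewrite /preimage /= mslat_funI; exact: mfilterI.
Qed.
Next Obligation.
move=> M N f; apply: continuous_to_filter_space => m.
exact: clopen_containing.
Qed.
Next Obligation. by move=> M N f F G FG m; exact: FG. Qed.

Lemma preimage_containing (M N : mslat) (f : mslat_hom M N) (m : M) :
  filter_preimage f @^-1` containing m = containing (f m).
Proof. by []. Qed.

Lemma filter_preimage_wi (M N : mslat) (f : mslat_hom M N) :
  wi_preserving (filter_preimage f).
Proof.
move=> U /wi_containing[m ->]; rewrite preimage_containing.
exact: containing_wi.
Qed.

Lemma filter_preimage_functor :
  @is_functor (op MsLat) PTop filter_space
    (fun (N M : op MsLat) (f : @hom (op MsLat) N M) => filter_preimage f).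
Proof.
split=> [M|M N P g f]; apply: ptop_hom_eq; apply/funext => F;
  exact: mfilter_eq.
Qed.

Definition filter_functor : functor (op MsLat) PTop :=
  Functor filter_preimage_functor.

(** * The semilattice of weakly indecomposable sets *)

(** The closure hypothesis is an argument of the type because the meet and the
    top of the semilattice structure put on this type are built from it. *)
Definition wi_set (X : ptop) of wi_meet_closed X :=
  {U : set X | weakly_indecomposable U}.

Section WiLattice.
Variables (X : ptop) (h : wi_meet_closed X).
Local Notation wi_set := (wi_set h).

HB.instance Definition _ := gen_eqMixin wi_set.
HB.instance Definition _ := gen_choiceMixin wi_set.

Definition wi_le : rel wi_set := fun U V => `[< sval U `<=` sval V >].

Lemma wi_le_refl : reflexive wi_le.
Proof. by move=> U; apply/asboolP. Qed.

Lemma wi_le_anti : antisymmetric wi_le.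
Proof.
by move=> U V /andP[/asboolP UV /asboolP VU]; apply: sval_eq; apply/seteqP.
Qed.

Lemma wi_le_trans : transitive wi_le.
Proof.
by move=> V U W /asboolP UV /asboolP VW; apply/asboolP; exact: subset_trans VW.
Qed.

HB.instance Definition _ := Order.Le_isPOrder.Build (Order.Disp tt tt) wi_set
  wi_le_refl wi_le_anti wi_le_trans.

Definition wi_meet (U V : wi_set) : wi_set :=
  exist _ (sval U `&` sval V) (h.2 _ _ (svalP U) (svalP V)).

Lemma wi_lexI (U V W : wi_set) :
  wi_le U (wi_meet V W) = wi_le U V && wi_le U W.
Proof.
apply/asboolP/andP => [UVW|[/asboolP UV /asboolP UW] x Ux].
  by split; apply/asboolP => x /UVW[].
by split; [exact: UV|exact: UW].
Qed.

Lemma wi_lex1 (U : wi_set) : wi_le U (exist _ [set: X] h.1).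
Proof. exact/asboolP. Qed.

HB.instance Definition _ := Order.POrder_isMeetSemilattice.Build
  (Order.Disp tt tt) wi_set wi_lexI.
HB.instance Definition _ := Order.hasTop.Build
  (Order.Disp tt tt) wi_set wi_lex1.

Definition wi_lattice : mslat := wi_set.

End WiLattice.

(** If [U] had no least point, every [x] in [U] would fail to be below some
    point [y] of [U], and a clopen upper set through [x] that avoids [y] would
    cut out of [U] a proper part containing [x]; such parts would decompose
    [U]. *)
Lemma priestley_wi_principal (X : ptop) (U : set X) : priestley X ->
  weakly_indecomposable U -> exists2 x, U x & U `<=` ple x.
Proof.
move=> [_ _ sepX] [[cU upU] UC]; apply: contrapT => noleast.
pose C := [set V : set X | [/\ clopen_upper V, V `<=` U & V <> U]].
suff [] : C U by [].
apply: UC => [V []//|].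
apply/seteqP; split=> [x Ux|x [V [_ VU _] Vx]]; last exact: VU.
have [y Uy xy] : exists2 y, U y & ~ ple x y.
  apply: contrapT => Uxy; apply: noleast; exists x => // y Uy.
  by apply: contrapT => xy; apply: Uxy; exists y.
have [V [[cV upV] Vx Vy]] := sepX _ _ xy.
exists (U `&` V) => //; split.
- split; first exact: clopenI.
  by move=> a b ab [Ua Va]; split; [exact: upU ab Ua|exact: upV ab Va].
- by move=> z [].
- by move=> UV; apply: Vy; move: Uy; rewrite -UV => -[].
Qed.

(** * Points as filters of weakly indecomposable sets *)

Section Unit.
Variables (X : ptop) (h : wi_meet_closed X).
Local Notation L := (wi_lattice h).

Program Definition unit_point (x : X) : filter_space L :=
  @MFilter L [set U : L | sval (U : wi_set h) x] _ _ _.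
Next Obligation. by move=> x U V /asboolP UV; exact: UV. Qed.
Next Obligation. by []. Qed.
Next Obligation. by []. Qed.

Lemma unit_containing (U : L) :
  unit_point @^-1` containing U = sval (U : wi_set h).
Proof. by []. Qed.

Program Definition unit_hom : ptop_hom X (filter_space L) :=
  @PTopHom X (filter_space L) unit_point _ _.
Next Obligation.
apply: continuous_to_filter_space => U; rewrite unit_containing.
by have [[]] := svalP (U : wi_set h).
Qed.
Next Obligation.
move=> x y xy U /= Ux; have [[_ upU] _] := svalP (U : wi_set h).
exact: upU xy Ux.
Qed.

Hypotheses (pX : priestley X) (sX : wi_separated X).

Lemma unit_reflects_le (x y : X) : ple (unit_hom x) (unit_hom y) -> ple x y.
Proof.
move=> xy; apply: contrapT => /sX[U [wU Ux]]; apply.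
exact: (xy (exist _ U wU : wi_set h)).
Qed.

(** The preimage [x] of [F] is a cluster point of the net of least points [s V],
    [V] in [F].  If [U] is in [F] then [s V] is in [U] as soon as [V] is
    included in [U], and [U] is closed.  If [x] is in [U], which is open, then
    some [s V] is in [U], hence [V] is included in [U] and [U] is in [F]. *)
Lemma unit_surj (F : filter_space L) : exists x, unit_hom x = F.
Proof.
have /choice[s sP] (U : L) : exists x : X,
    sval (U : wi_set h) x /\ sval (U : wi_set h) `<=` ple x.
  by have [x] := priestley_wi_principal pX (svalP (U : wi_set h)); exists x.
have [cX _ _] := pX.
have [|x [_ Fx]] := cX (tails F s) (tails_proper F s).
  exact: (@filterT _ _ (@filter_filter _ _ (tails_proper F s))).
exists x; apply: mfilter_eq; apply/seteqP; split=> U /= UP.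
- have [[[oU _] upU] _] := svalP (U : wi_set h).
  have [_ [[V [FV _] <-] UV]] : [set s n | n in
      [set n | mfilter_set F n /\ (n <= \top)%O]] `&` sval (U : wi_set h) !=set0.
    apply: Fx; last exact: open_nbhs_nbhs.
    by exists \top%O => //; exact: mfilter1.
  apply: mfilter_up FV; apply/asboolP => y Vy.
  by apply: upU UV; exact: (sP V).2.
- have [[[_ cU] _] _] := svalP (U : wi_set h).
  apply: contrapT => Ux.
  have [_ [[V [FV /asboolP VU] <-] []]] : [set s n | n in
      [set n | mfilter_set F n /\ (n <= U)%O]] `&` ~` sval (U : wi_set h) !=set0.
    apply: Fx; first by exists U.
    by apply: open_nbhs_nbhs; split=> //; rewrite openC.
  exact/VU/(sP V).1.
Qed.

Lemma unit_iso : @is_iso PTop X (filter_space L) unit_hom.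
Proof.
have /choice[g gK] := unit_surj.
have Kg : cancel unit_hom g.
  move=> x; have [_ anti _] := pX.
  by apply: anti; apply: unit_reflects_le; rewrite gK; exact: ple_refl.
(* The preimage under [g] of a closed set is its image under the unit, which
   is compact, hence closed in a Hausdorff space. *)
have gc : continuous g.
  apply/continuous_closedP => A cA.
  have -> : g @^-1` A = unit_hom @` A.
    apply/seteqP; split=> [F gF|_ [x Ax <-]]; last by rewrite /preimage /= Kg.
    by exists (g F).
  apply: compact_closed; first exact: filter_space_hausdorff.
  apply: continuous_compact.
    by apply: continuous_subspaceT; exact: ptop_fun_cts.
  have [cX _ _] := pX; exact: subclosed_compact cA cX _.
have gle (F G : filter_space L) : ple F G -> ple (g F) (g G).
  by move=> FG; apply: unit_reflects_le; rewrite !gK.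
exists (@PTopHom (filter_space L) X g gc gle).
by split; apply: ptop_hom_eq; apply/funext => x /=.
Qed.

End Unit.

(** * Naturality and invariance under isomorphism *)

Program Definition wi_preimage (X Y : ptop) (f : ptop_hom X Y)
    (hX : wi_meet_closed X) (hY : wi_meet_closed Y) (fwi : wi_preserving f) :
    mslat_hom (wi_lattice hY) (wi_lattice hX) :=
  @MslatHom (wi_lattice hY) (wi_lattice hX)
    (fun U : wi_set hY =>
       exist _ (f @^-1` (sval U)) (fwi _ (svalP U)) : wi_set hX) _ _.
Next Obligation. by move=> *; exact: sval_eq. Qed.
Next Obligation. by move=> *; exact: sval_eq. Qed.

Lemma unit_natural (X Y : ptop) (f : ptop_hom X Y)
    (hX : wi_meet_closed X) (hY : wi_meet_closed Y) (fwi : wi_preserving f) :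
  @Defs.comp PTop _ _ _ (unit_hom hY) f =
  @Defs.comp PTop _ _ _ (filter_preimage (wi_preimage hX hY fwi)) (unit_hom hX).
Proof. by apply: ptop_hom_eq; apply/funext => x; exact: mfilter_eq. Qed.

Lemma ptop_isoP (X Y : ptop) (f : @hom PTop X Y) : is_iso f ->
  exists2 g : ptop_hom Y X,
    cancel (f : ptop_hom X Y) g & cancel g (f : ptop_hom X Y).
Proof.
case=> g [/(congr1 (@ptop_fun _ _)) gf /(congr1 (@ptop_fun _ _)) fg].
by exists g => x; [have := congr1 (@^~ x) gf|have := congr1 (@^~ x) fg].
Qed.

Lemma clopen_upper_preimage (X Y : ptop) (f : ptop_hom X Y) (U : set Y) :
  clopen_upper U -> clopen_upper (f @^-1` U).
Proof.
move=> [cU upU]; split.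
  exact: preimage_clopen cU (@ptop_fun_cts _ _ f).
by move=> x y xy; apply: upU; exact: ptop_fun_le.
Qed.

(** A decomposition of [f @^-1` U] is transported along the inverse [g] to a
    decomposition of [U]. *)
Lemma wi_preserving_iso (X Y : ptop) (f : ptop_hom X Y) (g : ptop_hom Y X) :
  cancel f g -> cancel g f -> wi_preserving f.
Proof.
move=> fK gK U [cU UC]; split=> [|C CV fU]; first exact: clopen_upper_preimage.
have gf V : f @^-1` (g @^-1` V) = V.
  by apply/seteqP; split=> x; rewrite /preimage /= fK.
have fg V : g @^-1` (f @^-1` V) = V.
  by apply/seteqP; split=> x; rewrite /preimage /= gK.
apply: (UC [set W | C (f @^-1` W)]) => [W CW|].
  by rewrite -[W]fg; apply: clopen_upper_preimage; exact: CV.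
rewrite -[LHS]fg fU; apply/seteqP; split=> y [V CV' Vy].
  by exists (g @^-1` V) => //=; rewrite gf.
by exists (f @^-1` V) => //; rewrite /preimage /= gK.
Qed.

Definition filter_like (X : ptop) : Prop :=
  [/\ priestley X, wi_separated X & wi_meet_closed X].

Lemma filter_like_filter_space (M : mslat) : filter_like (filter_space M).
Proof.
split; [exact: filter_space_priestley|exact: filter_space_wi_separated|].
exact: filter_space_wi_meet_closed.
Qed.

Lemma filter_like_iso (X Y : ptop) (f : ptop_hom X Y) (g : ptop_hom Y X) :
  cancel f g -> cancel g f -> filter_like X -> filter_like Y.
Proof.
move=> fK gK [[cX anti sepX] wsX [wT wI]].
have fwi := wi_preserving_iso fK gK; have gwi := wi_preserving_iso gK fK.
have gle (x y : Y) : ~ ple x y -> ~ ple (g x) (g y).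
  by move=> xy gxy; apply: xy; rewrite -[x]gK -[y]gK; exact: ptop_fun_le.
split; first split.
- have -> : [set: Y] = f @` [set: X].
    by apply/seteqP; split=> // y _; exists (g y).
  apply: continuous_compact cX; apply: continuous_subspaceT.
  exact: ptop_fun_cts.
- move=> x y xy yx; apply: (can_inj gK).
  by apply: anti; exact: ptop_fun_le.
- move=> x y /gle/sepX[U [cU Ux Uy]]; exists (g @^-1` U); split=> //.
  exact: clopen_upper_preimage.
- move=> x y /gle/wsX[U [wU Ux Uy]]; exists (g @^-1` U); split=> //.
  exact: gwi.
- split=> [|U V /fwi wU /fwi wV]; first exact: (gwi _ wT).
  have := gwi _ (wI _ _ wU wV); congr weakly_indecomposable.
  by apply/seteqP; split=> y; rewrite /preimage /= gK.
Qed.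

(** * The extended image of the filter functor *)

Program Definition filter_like_spaces : subcategory PTop :=
  @Subcategory PTop filter_like
    (fun X Y f => [/\ filter_like X, filter_like Y &
                      wi_preserving (f : ptop_hom X Y)]) _ _ _ _.
Next Obligation. by move=> X Y f []. Qed.
Next Obligation. by move=> X Y f []. Qed.
Next Obligation. by move=> X hX; split. Qed.
Next Obligation.
by move=> X Y Z g f [_ hZ gwi] [hX _ fwi]; split=> // U /gwi/fwi.
Qed.

Lemma filter_like_spaces_replete : replete filter_like_spaces.
Proof.
move=> X Y f hX /ptop_isoP[g fK gK]; split=> //.
  exact: filter_like_iso fK gK hX.
exact: wi_preserving_iso fK gK.
Qed.

Lemma filter_like_spaces_factors :
  factors_through filter_functor filter_like_spaces.
Proof.
split=> [M|M N f]; first exact: filter_like_filter_space.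
by split; [exact: filter_like_filter_space..|exact: filter_preimage_wi].
Qed.

Lemma filter_like_unit_iso (X : ptop) (hX : filter_like X)
    (h : wi_meet_closed X) :
  @is_iso PTop X (filter_space (wi_lattice h)) (unit_hom h).
Proof. by case: hX => pX sX _; exact: unit_iso. Qed.

Section InImage.
Variables (S : subcategory PTop) (rS : replete S).
Hypothesis FS : factors_through filter_functor S.

Lemma shom_unit_inverse (X : ptop) (hX : filter_like X) (h : wi_meet_closed X) :
  exists2 u : @hom PTop (filter_space (wi_lattice h)) X,
    shom S u & @Defs.comp PTop _ _ _ u (unit_hom h) = @idm PTop X.
Proof.
have [u [ue eu]] := filter_like_unit_iso hX h.
exists u => //; apply: rS; first exact: FS.1.
by exists (unit_hom h).
Qed.

Lemma filter_like_sobj (X : ptop) : filter_like X -> sobj S X.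
Proof.
move=> hX; have [_ _ h] := hX.
have [u Su _] := shom_unit_inverse hX h; exact: shom_cod Su.
Qed.

(** Naturality of the unit expresses [f] through arrows that lie in every
    replete subcategory containing the image of the functor: the unit of [X],
    an arrow in that image, and the inverse [u] of the unit of [Y]. *)
Lemma wi_preserving_shom (X Y : ptop) (f : ptop_hom X Y) :
  filter_like X -> filter_like Y -> wi_preserving f ->
  shom S (f : @hom PTop X Y).
Proof.
move=> LX LY fwi; have [[_ _ hX] [_ _ hY]] := (LX, LY).
have [u Su uE] := shom_unit_inverse LY hY.
have -> : (f : @hom PTop X Y) = Defs.comp u
   (Defs.comp (filter_preimage (wi_preimage hX hY fwi) : @hom PTop _ _)
     (unit_hom hX : @hom PTop _ _)).
  by rewrite -unit_natural compmA uE comp1m.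
apply: shom_comp => //; apply: shom_comp; first exact: (FS.2).
by apply: rS; [exact: filter_like_sobj|exact: filter_like_unit_iso].
Qed.

End InImage.

Lemma sobj_extended_image (X : ptop) :
  sobj (extended_image filter_functor) X <-> filter_like X.
Proof.
split=> [SX|hX S rS FS]; last exact: filter_like_sobj.
exact: (SX _ filter_like_spaces_replete filter_like_spaces_factors).
Qed.

Lemma shom_extended_image (X Y : ptop) (f : ptop_hom X Y) :
  shom (extended_image filter_functor) (f : @hom PTop X Y) <->
  [/\ sobj (extended_image filter_functor) X,
      sobj (extended_image filter_functor) Y & wi_preserving f].
Proof.
split=> [Sf|[/sobj_extended_image hX /sobj_extended_image hY fwi] S rS FS].
  split; [exact: shom_dom Sf|exact: shom_cod Sf|].
  by have [] := Sf _ filter_like_spaces_replete filter_like_spaces_factors.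
exact: wi_preserving_shom.
Qed.

(** * The equivalence *)

Program Definition containing_hom (M : mslat)
    (h : wi_meet_closed (filter_space M)) : mslat_hom M (wi_lattice h) :=
  @MslatHom M (wi_lattice h)
    (fun m => exist _ (containing m) (containing_wi m) : wi_set h) _ _.
Next Obligation. by move=> M h m n; apply: sval_eq; exact: containingI. Qed.
Next Obligation. by move=> M h; apply: sval_eq; exact: containing1. Qed.

Lemma containing_iso (M : mslat) (h : wi_meet_closed (filter_space M)) :
  @is_iso MsLat M (wi_lattice h) (containing_hom h).
Proof.
have /choice[g gK] (U : wi_lattice h) : exists m, containing_hom h m = U.
  have [m Um] := wi_containing (svalP (U : wi_set h)).
  by exists m; exact: sval_eq.
have inj : injective (containing_hom h).
  move=> m n /(congr1 sval) /= mn.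
  by apply/le_anti; rewrite !containing_sub_le// mn.
have gI (U V : wi_lattice h) : g (U `&` V)%O = (g U `&` g V)%O.
  by apply: inj; rewrite gK mslat_funI !gK.
have g1 : g \top%O = \top%O by apply: inj; rewrite gK mslat_fun1.
exists (@MslatHom (wi_lattice h) M g gI g1).
split; apply: mslat_hom_eq; apply/funext => x /=; last exact: gK.
by apply: inj; rewrite gK.
Qed.

Local Notation dual := (subcat (extended_image filter_functor)).

Lemma dual_filter_like (X : dual) : filter_like (sval X).
Proof. exact/sobj_extended_image/(svalP X). Qed.

Lemma dual_meet_closed (X : dual) : wi_meet_closed (sval X).
Proof. by case: (dual_filter_like X). Qed.

Lemma dual_wi_preserving (X Y : dual) (f : hom X Y) :
  wi_preserving (sval f : ptop_hom _ _).
Proof. by have /shom_extended_image[] := svalP f. Qed.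

Program Definition wi_functor : functor dual (op MsLat) :=
  @Functor dual (op MsLat) (fun X => wi_lattice (dual_meet_closed X))
    (fun X Y f => wi_preimage (dual_meet_closed X) (dual_meet_closed Y)
                    (dual_wi_preserving f)) _.
Next Obligation.
split=> [X|X Y Z g f]; apply: mslat_hom_eq; apply/funext => U; exact: sval_eq.
Qed.

Lemma corestriction_equivalence : is_equivalence (corestriction filter_functor).
Proof.
exists wi_functor; split.
  exists (fun M =>
    containing_hom (dual_meet_closed (corestriction filter_functor M))).
  split=> [M N f|M]; last by apply: is_iso_op; exact: containing_iso.
  by apply: mslat_hom_eq; apply/funext => m; exact: sval_eq.
(* The unit maps every space to its double dual, the direction opposite to the
   one in the definition of an equivalence. *)
apply: nat_iso_sym.
have Su (X : dual) : shom (extended_image filter_functor)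
    (unit_hom (dual_meet_closed X) : @hom PTop _ _).
  apply: extended_image_replete; first exact: svalP.
  by apply: filter_like_unit_iso; exact: dual_filter_like.
exists (fun X => exist _ _ (Su X)); split=> [X Y f|X].
  by apply: sval_eq; exact: unit_natural.
apply: is_iso_subcat; first exact: extended_image_replete.
by apply: filter_like_unit_iso; exact: dual_filter_like.
Qed.

Theorem mainTheorem3 :
  exists Bmap : forall M N : mslat,
      mslat_hom M N -> ptop_hom (filter_space N) (filter_space M),
    (forall (M N : mslat) (f : mslat_hom M N) (F : filter_space N),
       mfilter_set (Bmap M N f F) = f @^-1` (mfilter_set F)) /\
    exists B_functor : @is_functor (op MsLat) PTop filter_space
                         (fun (N M : op MsLat) (f : @hom (op MsLat) N M) =>
                            Bmap M N f),
      let B : functor (op MsLat) PTop := Functor B_functor in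
      is_equivalence (corestriction B) /\
      (forall X : ptop,
         sobj (extended_image B) X <->
         [/\ priestley X, wi_separated X & wi_meet_closed X]) /\
      (forall (X Y : ptop) (f : ptop_hom X Y),
         shom (extended_image B) (f : @hom PTop X Y) <->
         [/\ sobj (extended_image B) X, sobj (extended_image B) Y &
             wi_preserving f]).
Proof.
exists filter_preimage; split=> //; exists filter_preimage_functor.
split; first exact: corestriction_equivalence.
by split; [exact: sobj_extended_image|exact: shom_extended_image].
Qed.
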